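(* Let $H_1,H_2$ be real Hilbert spaces, let $C\subset H_1$ and $Q\subset H_2$ be nonempty closed convex subsets, let $A:H_1\to H_2$ be a bounded linear operator, and let $f:C\times C\to\mathbb{R}$ and $g:Q\times Q\to\mathbb{R}$ be bifunctions. Then the split equilibrium problem (SEP) determined by $(C,Q,A,f,g)$ is generalized well-posed if and only if its solution set $S$ is nonempty and compact, and $$H(S(\epsilon),S)\to 0\quad\text{as }\epsilon\to 0$$ (with $\epsilon>0$), where $H(\cdot,\cdot)$ denotes the Hausdorff metric.
   Context: The product $H_1\times H_2$ carries its usual Hilbert space norm; compactness is with respect to the norm topology. Split equilibrium problem (SEP): find $x^*\in C$ such that $f(x^*,p)\ge 0$ for all $p\in C$, and such that $y^*=Ax^*$ belongs to $Q$ and satisfies $g(y^*,q)\ge 0$ for all $q\in Q$. A solution is identified with the pair $(x^*,y^* )=(x^*,Ax^* )$, so the solution set is $$S=\{(x,y)\in C\times Q:\ y=Ax,\ f(x,p)\ge 0\ \forall p\in C,\ g(y,q)\ge 0\ \forall q\in Q\}.$$ For $\epsilon\ge 0$, the approximate solution set is $$S(\epsilon)=\{(x,y)\in C\times Q:\ \|y-Ax\|\le\epsilon,\ f(x,p)\ge-\epsilon\ \forall p\in C,\ g(y,q)\ge-\epsilon\ \forall q\in Q\}.$$ A sequence $\{(x_n,y_n)\}$ in $H_1\times H_2$ is an approximating sequence for the SEP if there exist real numbers $\epsilon_n>0$ with $\epsilon_n\to 0$ such that, for all $n$: $x_n\in C$, $y_n\in Q$, $\|y_n-Ax_n\|\le\epsilon_n$,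 $f(x_n,p)\ge-\epsilon_n$ for all $p\in C$, and $g(y_n,q)\ge-\epsilon_n$ for all $q\in Q$. The SEP is generalized well-posed if $S\ne\emptyset$ and every approximating sequence for the SEP has a subsequence which converges (in norm) to some element of $S$. For nonempty subsets $U,V$ of a Hilbert space, $H(U,V)=\max\{D(U,V),D(V,U)\}$ (possibly $+\infty$), where $D(U,V)=\sup_{u\in U}d(u,V)$ and $d(u,V)=\inf_{v\in V}\|u-v\|$. *)

(* Defs.v *)
From HB Require Import structures.
From mathcomp Require Import all_boot all_order all_algebra.
From mathcomp Require Import ring.
From mathcomp Require Import all_classical all_reals all_analysis.

Set Implicit Arguments.
Unset Strict Implicit.
Unset Printing Implicit Defensive.

Import Order.TTheory GRing.Theory Num.Theory.
Import numFieldNormedType.Exports.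

Local Open Scope classical_set_scope.
Local Open Scope ring_scope.

(* A real Hilbert space: a complete normed module whose norm is induced by a
   symmetric positive definite bilinear form. *)
HB.mixin Record CompleteNormedModule_isHilbert (R : realType) V
    & CompleteNormedModule R V := {
  inner : {dot V for (@idfun R)};
  sqr_normE : forall x : V, `|x| ^+ 2 = inner x x
}.

#[short(type="hilbertType")]
HB.structure Definition Hilbert (R : realType) :=
  {V of CompleteNormedModule R V & CompleteNormedModule_isHilbert R V}.

(* The library norms [U * V] by the maximum of the two norms; [hprod U V] is
   the same vector space with the Hilbert norm sqrt (|x|^2 + |y|^2). *)
Definition hprod (U V : Type) : Type := (U * V)%type.

Section hprod_normed.
Variables (R : realType) (U V : normedModType R).

HB.instance Definition _ := GRing.Lmodule.copy (hprod U V) (U * V)%type.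

Definition hprod_norm (z : hprod U V) : R :=
  Num.sqrt (`|z.1| ^+ 2 + `|z.2| ^+ 2).

Let ler_hprod_normD (z w : hprod U V) :
  hprod_norm (z + w) <= hprod_norm z + hprod_norm w.
Proof.
case: z w => [a b] [c d]; rewrite /hprod_norm /=.
set p := `|a|; set q := `|b|; set r := `|c|; set s := `|d|.
have [p0 q0 r0 s0] : [/\ 0 <= p, 0 <= q, 0 <= r & 0 <= s].
  by split; exact: normr_ge0.
have P0 : 0 <= p ^+ 2 + q ^+ 2 by rewrite addr_ge0 ?sqr_ge0.
have Q0 : 0 <= r ^+ 2 + s ^+ 2 by rewrite addr_ge0 ?sqr_ge0.
have cs : p * r + q * s <=
    Num.sqrt (p ^+ 2 + q ^+ 2) * Num.sqrt (r ^+ 2 + s ^+ 2).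
  rewrite -sqrtrM// -[leLHS]ger0_norm ?addr_ge0 ?mulr_ge0// -sqrtr_sqr.
  rewrite ler_sqrt ?mulr_ge0// -subr_ge0.
  rewrite [X in 0 <= X](_ : _ = (p * s - q * r) ^+ 2) ?sqr_ge0//.
  by ring.
rewrite -[leRHS]ger0_norm ?addr_ge0 ?sqrtr_ge0// -sqrtr_sqr.
rewrite ler_sqrt ?sqr_ge0// sqrrD !sqr_sqrtr//.
have le1 : `|a + c| ^+ 2 <= (p + r) ^+ 2.
  by rewrite lerXn2r ?nnegrE ?addr_ge0// ler_normD.
have le2 : `|b + d| ^+ 2 <= (q + s) ^+ 2.
  by rewrite lerXn2r ?nnegrE ?addr_ge0// ler_normD.
apply: (le_trans (lerD le1 le2)).
rewrite [leLHS](_ : _ = p ^+ 2 + q ^+ 2 + (p * r + q * s) *+ 2 +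
  (r ^+ 2 + s ^+ 2)); last by ring.
by rewrite lerD2r lerD2l lerMn2r.
Qed.

Let hprod_normZ (k : R) (z : hprod U V) :
  hprod_norm (k *: z) = `|k| * hprod_norm z.
Proof.
rewrite /hprod_norm /= !normrZ !exprMn -mulrDr sqrtrM ?sqr_ge0//.
by rewrite sqrtr_sqr normr_id.
Qed.

Let hprod_norm_eq0 (z : hprod U V) : hprod_norm z = 0 -> z = 0.
Proof.
case: z => a b /eqP; rewrite /hprod_norm /= sqrtr_eq0 => le0.
have: `|a| ^+ 2 + `|b| ^+ 2 == 0 by rewrite eq_le le0 addr_ge0 ?sqr_ge0.
rewrite paddr_eq0 ?sqr_ge0// !sqrf_eq0 !normr_eq0.
by move=> /andP[/eqP-> /eqP->].
Qed.

HB.instance Definition _ := Lmodule_isNormed.Build R (hprod U V)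
  ler_hprod_normD hprod_normZ hprod_norm_eq0.

Lemma hprod_normE (z : hprod U V) :
  `|z| = Num.sqrt (`|z.1| ^+ 2 + `|z.2| ^+ 2).
Proof. by []. Qed.

Lemma le_hprod_norm1 (z : hprod U V) : `|z.1| <= `|z|.
Proof.
rewrite hprod_normE -[leLHS]ger0_norm// -sqrtr_sqr.
by rewrite ler_sqrt ?addr_ge0 ?sqr_ge0// lerDl sqr_ge0.
Qed.

Lemma le_hprod_norm2 (z : hprod U V) : `|z.2| <= `|z|.
Proof.
rewrite hprod_normE -[leLHS]ger0_norm// -sqrtr_sqr.
by rewrite ler_sqrt ?addr_ge0 ?sqr_ge0// lerDr sqr_ge0.
Qed.

Lemma hprod_norm_le (z : hprod U V) : `|z| <= `|z.1| + `|z.2|.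
Proof.
rewrite hprod_normE -[leRHS]ger0_norm ?addr_ge0// -sqrtr_sqr.
rewrite ler_sqrt ?sqr_ge0// sqrrD -addrA lerD2l lerDr.
by rewrite mulrn_wge0 // mulr_ge0.
Qed.

End hprod_normed.

Section hprod_complete.
Variables (R : realType) (U V : completeNormedModType R).

Let hprod_cauchy_cvg (F : set_system (hprod U V)) :
  ProperFilter F -> cauchy F -> cvg F.
Proof.
move=> FF /cauchy_ballP Fc.
have c1 : cvg ((fst : hprod U V -> U) @ F).
  apply: cauchy_cvg; apply/cauchy_ballP => e e0.
  have := Fc _ e0; rewrite !near_simpl.
  case=> -[P Q] [FP FQ] PQ; exists (fst @` P, fst @` Q).
    by split; rewrite /= ?nbhs_filterE; [apply: filterS FP|apply: filterS FQ] => z ?; exists z.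
  move=> [_ _] [/= [x Px <-] [y Qy <-]].
  have /= := PQ (x, y) (conj Px Qy); rewrite -!ball_normE /=.
  by apply: le_lt_trans; exact: (le_hprod_norm1 (x - y)).
have c2 : cvg ((snd : hprod U V -> V) @ F).
  apply: cauchy_cvg; apply/cauchy_ballP => e e0.
  have := Fc _ e0; rewrite !near_simpl.
  case=> -[P Q] [FP FQ] PQ; exists (snd @` P, snd @` Q).
    by split; rewrite /= ?nbhs_filterE; [apply: filterS FP|apply: filterS FQ] => z ?; exists z.
  move=> [_ _] [/= [x Px <-] [y Qy <-]].
  have /= := PQ (x, y) (conj Px Qy); rewrite -!ball_normE /=.
  by apply: le_lt_trans; exact: (le_hprod_norm2 (x - y)).
move: c1 c2 => /cvg_ex[/= a Fa] /cvg_ex[/= b Fb].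
apply/cvg_ex; exists ((a, b) : hprod U V).
apply/cvgrPdist_lt => e e0.
have e20 : 0 < e / 2 by rewrite divr_gt0.
move/cvgrPdist_lt : Fa => /(_ _ e20) Fa.
move/cvgrPdist_lt : Fb => /(_ _ e20) Fb.
near=> z.
apply: (le_lt_trans (hprod_norm_le _)); rewrite (splitr e) ltrD//=.
- by near: z.
- by near: z.
Unshelve. all: by end_near. Qed.

HB.instance Definition _ :=
  Uniform_isComplete.Build (hprod U V) hprod_cauchy_cvg.

End hprod_complete.

Section hprod_hilbert.
Variables (R : realType) (U V : hilbertType R).

Definition hprod_inner (z w : hprod U V) : R :=
  inner z.1 w.1 + inner z.2 w.2.

Let hprod_inner_bilinear :
  bilinear_for ( *%R : R -> R -> R) (idfun \; *%R : R -> R -> R) hprod_inner.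
Proof.
split=> [w|w] k z z'; rewrite /hprod_inner /=.
- by rewrite /applyr !linearPl /= mulrDr addrACA.
- by rewrite !linearPr /= mulrDr addrACA.
Qed.

HB.instance Definition _ := bilinear_isBilinear.Build R (hprod U V) (hprod U V)
  R _ _ hprod_inner hprod_inner_bilinear.

Let hprod_inner_sym (z w : hprod U V) :
  hprod_inner z w = (-1) ^+ false * idfun (hprod_inner w z).
Proof.
rewrite expr0 mul1r /hprod_inner /=.
by congr (_ + _); rewrite hermitian_subproof expr0 mul1r.
Qed.

HB.instance Definition _ :=
  isHermitianSesquilinear.Build R (hprod U V) false idfun hprod_inner
    hprod_inner_sym.

Let sqr_hprod_norm (z : hprod U V) : `|z| ^+ 2 = hprod_inner z z.
Proof.
by rewrite hprod_normE sqr_sqrtr ?addr_ge0 ?sqr_ge0// !sqr_normE.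
Qed.

Let hprod_inner_gt0 (z : hprod U V) : z != 0 -> 0 < hprod_inner z z.
Proof. by move=> z0; rewrite -sqr_hprod_norm exprn_gt0 ?normr_gt0. Qed.

HB.instance Definition _ :=
  isDotProduct.Build R (hprod U V) hprod_inner hprod_inner_gt0.

HB.instance Definition _ :=
  CompleteNormedModule_isHilbert.Build R (hprod U V) sqr_hprod_norm.

End hprod_hilbert.

Section hausdorff_distance.
Variables (R : realType) (E : normedModType R).
Local Open Scope ereal_scope.

Definition dist_set (u : E) (V : set E) : \bar R :=
  ereal_inf [set `|u - v|%:E | v in V].

Definition excess (U V : set E) : \bar R :=
  ereal_sup [set dist_set u V | u in U].

Definition hausdorff_dist (U V : set E) : \bar R :=
  maxe (excess U V) (excess V U).

End hausdorff_distance.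

(* The bifunctions [f : C x C -> R] and [g : Q x Q -> R] are represented by
   total functions whose values off [C x C] and [Q x Q] are never used. *)
Section split_equilibrium_problem.
Variables (R : realType) (H1 H2 : hilbertType R).
Variables (C : set H1) (Q : set H2) (A : H1 -> H2).
Variables (f : H1 -> H1 -> R) (g : H2 -> H2 -> R).

Definition SEP_solutions : set (hprod H1 H2) :=
  [set z | [/\ C z.1, Q z.2, z.2 = A z.1,
               forall p, C p -> 0 <= f z.1 p &
               forall q, Q q -> 0 <= g z.2 q]].

Definition SEP_approx_solutions (eps : R) : set (hprod H1 H2) :=
  [set z | [/\ C z.1, Q z.2, `|z.2 - A z.1| <= eps,
               forall p, C p -> - eps <= f z.1 p &
               forall q, Q q -> - eps <= g z.2 q]].

Definition SEP_approximating (z : nat -> hprod H1 H2) : Prop :=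
  exists eps : nat -> R,
    [/\ forall n, 0 < eps n,
        eps n @[n --> \oo] --> 0 &
        forall n, SEP_approx_solutions (eps n) (z n)].

Definition SEP_generalized_well_posed : Prop :=
  SEP_solutions !=set0 /\
  forall z : nat -> hprod H1 H2, SEP_approximating z ->
    exists phi : nat -> nat, increasing_seq phi /\
      exists2 s, SEP_solutions s & z (phi n) @[n --> \oo] --> s.

End split_equilibrium_problem.

(* Main.v *)
Require Import Defs.
From HB Require Import structures.
From mathcomp Require Import all_boot all_order all_algebra.
From mathcomp Require Import all_classical all_reals all_analysis.

Set Implicit Arguments.
Unset Strict Implicit.
Unset Printing Implicit Defensive.

Import Order.TTheory GRing.Theory Num.Theory.
Import numFieldNormedType.Exports.

Local Open Scope classical_set_scope.
Local Open Scope ring_scope.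

(** The proof rests on two features of the approximate solution sets [S(eps)]:
    they grow with [eps], and they contain [S] as soon as [0 < eps]. For such a family, call it clustering when every sequence of
    points [z n] of [S(eps n)], with [eps n] positive and tending to 0, has a
    cluster point in [S]. Since a cluster point of a sequence is exactly the
    limit of a subsequence ([cluster_subseq_cvg]), generalized well-posedness
    says that [S] is nonempty and the family is clustering. Moreover, as [S]
    lies inside [S(eps)], one of the two excesses vanishes and the Hausdorff
    distance is the excess of [S(eps)] over [S].

    Suppose that the family is clustering. A sequence of points of [S] is
    approximating, so [S] is sequentially compact, hence compact
    ([compact_seq_cluster]). If the excess did not tend to 0, one could pick in
    each [S(1/(n+1))] a point at distance at least [d] from [S], for a fixed
    [d > 0]; no point of [S] is a cluster point of that sequence
    ([clustering_scheme_excess_cvg]).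

    Conversely, if the excess tends to 0, the distances from the terms of an
    approximating sequence to [S] tend to 0. Were no point of the compact set
    [S] a cluster point, the sequence would eventually stay away from a
    neighbourhood of each point of [S], hence by compactness at a uniform
    positive distance from [S], a contradiction
    ([compact_cluster_dist_cvg0]). *)

(** * Cluster points of sequences and sequential compactness *)

Section cluster_seq_norm.
Context {R : realType} {E : normedModType R}.
Implicit Types (u : nat -> E) (a : E).

Lemma cluster_seq_normP u a :
  cluster (u @ \oo) a <->
  forall (e : R) N, 0 < e -> exists2 n, (N <= n)%N & `|a - u n| < e.
Proof.
split=> [ua e N e0|ua P B [N _ NP]].
- have uN : (u @ \oo) [set x | exists2 n, (N <= n)%N & x = u n].
    by exists N => // n /= Nn; exists n.
  have [_ [[n Nn ->]]] := ua _ _ uN (nbhsx_ballx a _ e0).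
  by rewrite -ball_normE; exists n.
- move=> /nbhs_ballP[e /= e0 aeB].
  have [n Nn aun] := ua e N e0.
  by exists (u n); split; [exact: NP|apply: aeB; rewrite -ball_normE].
Qed.

End cluster_seq_norm.

Section cluster_points.
Context {R : realType} {E : normedModType R}.
Implicit Types (u : nat -> E) (a : E).

(** Both sides only depend on the real sequence [`|a - u n|] and on its
    clustering at, or subconvergence to, 0; the known equivalence for real
    sequences then applies. *)
Lemma cluster_subseq_cvg u a : cluster (u @ \oo) a <->
  exists2 phi : nat -> nat, increasing_seq phi & u \o phi @ \oo --> a.
Proof.
have -> : cluster (u @ \oo) a <-> cluster ((fun n => `|a - u n|) @ \oo) (0 : R).
  split=> [/cluster_seq_normP h|/(@cluster_seq_normP R R^o) h].
    apply/(@cluster_seq_normP R R^o) => e N e0.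
    have [n Nn an] := h e N e0.
    by exists n => //; rewrite sub0r normrN normr_id.
  apply/cluster_seq_normP => e N e0; have [n Nn an] := h e N e0.
  by exists n => //; move: an; rewrite sub0r normrN normr_id.
rewrite cluster_eventually_cvg.
split=> -[phi phi_incr cvg_phi]; exists phi => //.
- apply/cvgrPdist_lt => e e0; move/cvgrPdist_lt : cvg_phi => /(_ e e0).
  by apply: filterS => n /=; rewrite sub0r normrN normr_id.
- apply/cvgrPdist_lt => e e0; move/cvgrPdist_lt : cvg_phi => /(_ e e0).
  by apply: filterS => n /=; rewrite sub0r normrN normr_id.
Qed.

(** Total boundedness, phrased for ultrafilters. If no ball of radius [e]
    centred in [K] belongs to [F], removing from [K] one such ball after another
    always leaves a set of [F], so the process never stops and the successive
    centres form an [e]-separated sequence, which has no cluster point. *)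
Lemma seq_compact_small_ball (K : set E) (F : set_system E) (e : R) :
  (forall u, (forall n, K (u n)) -> exists2 s, K s & cluster (u @ \oo) s) ->
  UltraFilter F -> F K -> 0 < e -> exists2 x, K x & F (ball x e).
Proof.
move=> seqK FU FK e0; apply/not_exists2P => noball.
(* [D n] is [K] minus the first [n] balls, each centred at a point [xget 0] of
   what remained; the default 0 is never returned because [D n] is in [F]. *)
pose D n := iter n (fun B : set E => B `\` ball (xget 0 B) e) K.
have FD n : F (D n) /\ D n `<=` K.
  elim: n => [|n [FDn DnK]] /=; first by split.
  split; last by move=> x [/DnK].
  have [x Dx] := filter_ex FDn.
  have Dget : D n (xget 0 (D n)) by case: xgetP => // /(_ x).
  apply: filterI => //.
  have [/(_ (DnK _ Dget))//|FB] := noball (xget 0 (D n)).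
  by case: (in_ultra_setVsetC (ball (xget 0 (D n)) e) FU).
pose u n := xget 0 (D n).
have Du n : D n (u n).
  have [/filter_ex[x Dx] _] := FD n.
  by rewrite /u; case: xgetP => // /(_ x).
have D_anti m n : (m <= n)%N -> D n `<=` D m.
  move=> /subnKC <-; elim: (n - m)%N => [|k IH]; first by rewrite addn0.
  by rewrite addnS => x [/IH].
have sep m n : (m < n)%N -> e <= `|u m - u n|.
  move=> mn; have [_ far] : (D m `\` ball (u m) e) (u n).
    exact: D_anti mn _ (Du n).
  by rewrite leNgt; apply/negP => lt_e; apply: far; rewrite -ball_normE.
have [s _ /cluster_seq_normP us] := seqK u (fun n => (FD n).2 _ (Du n)).
have e20 : 0 < e / 2 by rewrite divr_gt0.
have [m _ sm] := us _ 0 e20; have [n mn sn] := us _ m.+1 e20.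
have := sep _ _ mn; apply/negP; rewrite -ltNge.
by rewrite (le_lt_trans (ler_distD s _ _))// (splitr e) ltrD// distrC.
Qed.

(** For the converse direction, an ultrafilter containing [K] contains a ball of
    radius [1/(n+1)] around some [u n] of [K], for every [n]; it converges to
    any cluster point of [u]. *)
Lemma compact_seq_cluster (K : set E) : compact K <->
  forall u, (forall n, K (u n)) -> exists2 s, K s & cluster (u @ \oo) s.
Proof.
split=> [cK u Ku|seqK].
  have [|s [Ks us]] := cK (u @ \oo) _; last by exists s.
  by apply: (filterE (F := \oo)) => n; exact: Ku.
rewrite compact_ultra => F FU FK.
have small n := seq_compact_small_ball seqK FU FK (@harmonic_gt0 R n).
pose u n := s2val (cid2 (small n)).
have Ku n : K (u n) by rewrite /u; case: cid2.
have Fu n : F (ball (u n) (harmonic n)) by rewrite /u; case: cid2.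
have [s Ks /cluster_seq_normP us] := seqK u Ku.
exists s; split=> // B /nbhs_ballP[e /= e0 seB].
have e20 : 0 < e / 2 by rewrite divr_gt0.
have [N _ Ne] := near_infty_natSinv_lt (PosNum e20).
have [n Nn sn] := us _ N e20.
apply: filterS (Fu n) => x; rewrite -ball_normE => /= unx.
apply: seB; rewrite -ball_normE /=.
rewrite (le_lt_trans (ler_distD (u n) _ _))// (splitr e) ltrD//.
by rewrite (lt_trans unx)//; exact: Ne.
Qed.

End cluster_points.

(** * Excess and Hausdorff distance *)

Section hausdorff_limits.
Context {R : realType} {E : normedModType R}.
Implicit Types (U V S : set E) (u : E) (e : R).
Local Open Scope ereal_scope.

Lemma dist_set_ge0 u V : 0 <= dist_set u V.
Proof.
by apply: le_ereal_inf_tmp => _ [v _ <-]; rewrite lee_fin.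
Qed.

Lemma dist_set_ltP u V e :
  dist_set u V < e%:E <-> exists2 v, V v & (`|u - v| < e)%R.
Proof.
split=> [/ereal_inf_lt[_ [v Vv <-]]|[v Vv uv]].
  by rewrite lte_fin; exists v.
apply: (@le_lt_trans _ _ `|u - v|%:E); last by rewrite lte_fin.
by apply: ereal_inf_lbound; exists v.
Qed.

Lemma excess_subset U V : U `<=` V -> excess U V <= 0.
Proof.
move=> UV; apply: ge_ereal_sup => _ [u Uu <-].
by apply: ereal_inf_lbound; exists u; [exact: UV|rewrite subrr normr0].
Qed.

Lemma excess_ge0 U V : U !=set0 -> 0 <= excess U V.
Proof.
move=> [u Uu]; apply: (le_trans (dist_set_ge0 u V)).
by apply: ereal_sup_ubound; exists u.
Qed.

Lemma hausdorff_dist_superset U S :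
  S !=set0 -> S `<=` U -> hausdorff_dist U S = excess U S.
Proof.
move=> S0 SU; apply/max_idPl.
rewrite (le_trans (excess_subset SU))// excess_ge0//.
by case: S0 => s /SU; exists s.
Qed.

Lemma ge0_cvge0P T (F : set_system T) (FF : Filter F) (h : T -> \bar R) :
  (\forall x \near F, 0 <= h x) ->
  h x @[x --> F] --> 0 <->
  forall e, (0 < e)%R -> \forall x \near F, h x <= e%:E.
Proof.
move=> h0; split=> [/fine_cvgP[hfin /cvgrPdist_le hcvg] e e0|hle].
  near=> x; rewrite -[h x]fineK; last by near: x.
  rewrite lee_fin (le_trans (ler_norm _))// -normrN -sub0r.
  by near: x; exact: hcvg.
have hfin : \forall x \near F, h x \is a fin_num.
  near=> x; rewrite ge0_fin_numE; last by near: x.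
  apply: (@le_lt_trans _ _ 1%:E); last exact: ltry.
  by near: x; exact: hle.
apply/fine_cvgP; split=> //; apply/cvgrPdist_le => e e0; near=> x.
have hx0 : 0 <= h x by near: x.
rewrite sub0r normrN ger0_norm ?fine_ge0// -lee_fin fineK; last by near: x.
by near: x; exact: hle.
Unshelve. all: by end_near. Qed.

End hausdorff_limits.

(** * Monotone approximations of a set *)

Section approximation_scheme.
Context {R : realType} {E : normedModType R}.
Variables (S : set E) (T : R -> set E).
Hypotheses (S0 : S !=set0) (ST : forall e, 0 < e -> S `<=` T e).

Lemma approximation_hausdorff_cvgP :
  hausdorff_dist (T e) S @[e --> 0^'+] --> 0%E <->
  excess (T e) S @[e --> 0^'+] --> 0%E.
Proof.
have near_eq : \forall e \near (0 : R)^'+,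
    hausdorff_dist (T e) S = excess (T e) S.
  near=> e; apply: hausdorff_dist_superset => //; apply: ST.
  by near: e; exact: nbhs_right_gt.
split; apply: cvg_trans; apply: near_eq_cvg => //.
by apply: filterS near_eq.
Unshelve. all: by end_near. Qed.

Let excess_approx_ge0 : \forall e \near (0 : R)^'+, (0 <= excess (T e) S)%E.
Proof.
near=> e; apply: excess_ge0; case: S0 => s /ST Ts; exists s; apply: Ts.
by near: e; exact: nbhs_right_gt.
Unshelve. all: by end_near. Qed.

Definition clustering_scheme := forall (z : nat -> E) (eps : nat -> R),
  (forall n, 0 < eps n) -> eps n @[n --> \oo] --> 0 ->
  (forall n, T (eps n) (z n)) -> exists2 s, S s & cluster (z @ \oo) s.

(** A sequence of points of [S] belongs to the approximation at any positive
    level, in particular at the levels [1/(n+1)]. *)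
Lemma clustering_scheme_compact : clustering_scheme -> compact S.
Proof.
move=> clT; apply/compact_seq_cluster => u Su.
apply: (clT u harmonic) => [n||n]; [exact: harmonic_gt0|exact: cvg_harmonic|].
by apply: ST; [exact: harmonic_gt0|exact: Su].
Qed.

(** By monotonicity of [T], it is enough to find one level [1/(n+1)] all of
    whose points are at distance less than [d] from [S]; otherwise a choice of
    bad points at each level has a cluster point [s] in [S], and one of them is
    within [d] of [s]. *)
Lemma clustering_scheme_excess_cvg :
  {homo T : a b / a <= b >-> a `<=` b} -> clustering_scheme ->
  excess (T e) S @[e --> 0^'+] --> 0%E.
Proof.
move=> T_homo clT; apply/(ge0_cvge0P _ excess_approx_ge0) => d d0.
suff [n Tn] : exists n : nat,
    forall x, T (harmonic n) x -> (dist_set x S < d%:E)%E.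
  near=> e; apply: ge_ereal_sup => _ [x Tx <-]; apply/ltW/Tn.
  apply: T_homo Tx; near: e; apply: nbhs_right_le; exact: harmonic_gt0.
apply: contrapT => /forallNP far.
have {}far n : exists2 x, T (harmonic n) x & ~ (dist_set x S < d%:E)%E.
  by have /existsNP[x /not_implyP[]] := far n; exists x.
pose z n := s2val (cid2 (far n)).
have Tz n : T (harmonic n) (z n) by rewrite /z; case: cid2.
have farz n : ~ (dist_set (z n) S < d%:E)%E by rewrite /z; case: cid2.
have [s Ss /cluster_seq_normP zs] := clT z _ (@harmonic_gt0 R) cvg_harmonic Tz.
have [n _ sz] := zs d 0 d0.
by apply: (farz n); apply/dist_set_ltP; exists s => //; rewrite distrC.
Unshelve. all: by end_near. Qed.

(** If the terms [z n] eventually stay at distance at least [d] from [x], where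
    [d] depends on [x], they stay at distance at least [d / 2] from all the
    points of [ball x (d / 2)]. Compactness, in its near-covering form, turns
    these local bounds into a positive lower bound valid on all of [S]. *)
Lemma compact_cluster_dist_cvg0 (z : nat -> E) : compact S ->
  (forall e, 0 < e -> \forall n \near \oo, (dist_set (z n) S < e%:E)%E) ->
  exists2 s, S s & cluster (z @ \oo) s.
Proof.
move=> cS zS; apply: contrapT => nocluster.
have far x : S x -> exists2 d : R, 0 < d &
    \forall n \near \oo, d <= `|x - z n|.
  move=> Sx; apply: contrapT => nod; apply: nocluster; exists x => //.
  apply/cluster_seq_normP => e N e0; apply: contrapT => noN.
  apply: nod; exists e => //; exists N => // n /= Nn.
  by rewrite leNgt; apply/negP => xz; apply: noN; exists n.
have /compact_near_coveringP/near_covering_withinP cov := cS.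
(* The filter carries an index [n] tending to infinity together with a candidate
   bound tending to 0 from above: every small enough bound works locally. *)
have : \forall nd \near filter_prod \oo (0 : R)^'+,
    S `<=` (fun x => nd.2 <= `|x - z nd.1|).
  apply: (cov _ _ (fun nd x => nd.2 <= `|x - z nd.1|)) => x /far[d d0 dz].
  have d20 : 0 < d / 2 by rewrite divr_gt0.
  exists (ball x (d / 2), [set nd | d <= `|x - z nd.1| /\ nd.2 <= d / 2]).
    split; first exact: nbhsx_ballx.
    exists ([set n | d <= `|x - z n|], [set e | e <= d / 2]).
      by split => //; exact: nbhs_right_le.
    by move=> [n e].
  move=> [y [n e]] /= [xy [dn ed]] _ /=; rewrite (le_trans ed)//.
  move: xy; rewrite -ball_normE /= => xy.
  have := le_trans dn (ler_distD y _ _).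
  rewrite [in X in X -> _](splitr d) => dle.
  by rewrite -(lerD2l (d / 2)) (le_trans dle)// lerD2r ltW.
move=> [[P D] [/= FP FD] PD].
have FD0 : \forall e \near (0 : R)^'+, 0 < e /\ D e.
  by apply: filterI => //; exact: nbhs_right_gt.
have [e [e0 De]] := filter_ex FD0.
have [n [/dist_set_ltP[s Ss zs] Pn]] := filter_ex (filterI (zS e e0) FP).
have := PD (n, e) (conj Pn De) s Ss; apply/negP.
by rewrite -ltNge distrC.
Qed.

Lemma compact_excess_clustering : compact S ->
  excess (T e) S @[e --> 0^'+] --> 0%E -> clustering_scheme.
Proof.
move=> cS /(ge0_cvge0P _ excess_approx_ge0) exT z eps eps0 eps_cvg Tz.
apply: compact_cluster_dist_cvg0 => // d d0.
have d20 : 0 < d / 2 by rewrite divr_gt0.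
have [r /= r0 rT] := exT _ d20.
move/cvgrPdist_lt : eps_cvg => /(_ _ r0); apply: filterS => n epsr.
apply: (@le_lt_trans _ _ (d / 2)%:E); last first.
  by rewrite lte_fin ltr_pdivrMr// ltr_pMr// ltr1n.
apply: le_trans (rT _ epsr (eps0 n)).
by apply: ereal_sup_ubound; exists (z n).
Qed.

End approximation_scheme.

(** * The split equilibrium problem *)

Section SEP.
Context {R : realType} {H1 H2 : hilbertType R}.
Variables (C : set H1) (Q : set H2) (A : H1 -> H2).
Variables (f : H1 -> H1 -> R) (g : H2 -> H2 -> R).

Lemma SEP_approx_solutions_homo :
  {homo SEP_approx_solutions C Q A f g : a b / a <= b >-> a `<=` b}.
Proof.
move=> a b ab z [Cz Qz zA fz gz]; split => //.
- exact: le_trans zA ab.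
- by move=> p /fz; apply: le_trans; rewrite lerN2.
- by move=> q /gz; apply: le_trans; rewrite lerN2.
Qed.

Lemma SEP_solutions_approx e : 0 < e ->
  SEP_solutions C Q A f g `<=` SEP_approx_solutions C Q A f g e.
Proof.
move=> e0 z [Cz Qz zA fz gz]; split => //.
- by rewrite zA subrr normr0 ltW.
- by move=> p /fz; apply: le_trans; rewrite oppr_le0 ltW.
- by move=> q /gz; apply: le_trans; rewrite oppr_le0 ltW.
Qed.

Lemma SEP_generalized_well_posed_clustering :
  SEP_generalized_well_posed C Q A f g <->
  SEP_solutions C Q A f g !=set0 /\
  clustering_scheme (SEP_solutions C Q A f g)
    (SEP_approx_solutions C Q A f g).
Proof.
split=> -[S0 wp]; split => // z.
- move=> eps eps0 eps_cvg Tz.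
  have [|phi [phi_incr [s Ss zs]]] := wp z; first by exists eps.
  by exists s => //; apply/cluster_subseq_cvg; exists phi.
- move=> [eps [eps0 eps_cvg Tz]].
  have [s Ss /cluster_subseq_cvg[phi phi_incr zs]] := wp z eps eps0 eps_cvg Tz.
  by exists phi; split => //; exists s.
Qed.

End SEP.

Theorem theorem3p8 (R : realType) (H1 H2 : hilbertType R)
    (C : set H1) (Q : set H2) (A : {linear H1 -> H2})
    (f : H1 -> H1 -> R) (g : H2 -> H2 -> R)
    (C_nonempty : C !=set0) (C_closed : closed C) (C_convex : convex_set C)
    (Q_nonempty : Q !=set0) (Q_closed : closed Q) (Q_convex : convex_set Q)
    (A_bounded : bounded_fun_norm A) :
  SEP_generalized_well_posed C Q A f g <->
  [/\ SEP_solutions C Q A f g !=set0,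
      compact (SEP_solutions C Q A f g) &
      hausdorff_dist (SEP_approx_solutions C Q A f g eps)
        (SEP_solutions C Q A f g) @[eps --> 0^'+] --> 0%E].
Proof.
have ST := @SEP_solutions_approx _ _ _ C Q A f g.
rewrite SEP_generalized_well_posed_clustering.
split=> [[S0 clT]|[S0 cS]].
- split => //; first exact: clustering_scheme_compact clT.
  apply/approximation_hausdorff_cvgP => //.
  by apply: clustering_scheme_excess_cvg => //; exact: SEP_approx_solutions_homo.
- move=> /(approximation_hausdorff_cvgP S0 ST) exT; split => //.
  exact: compact_excess_clustering.
Qed.
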